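(* For every real $\varepsilon>0$ there exists a constant $C_\varepsilon>0$ such that for every integer $N\geq 2$, $$\#\left\{(n,m)\in\mathbb{Z}^2 : 0\leq m\leq n<N,\ \gcd\left(\binom{n}{m},6\right)=1\right\}\leq C_\varepsilon\,\frac{N^{\log 3/\log 2}}{(\log N)^{2(1-\log_3 2)-\varepsilon}}.$$
   Context: Here $\log$ denotes the natural logarithm and $\log_3 2=\log 2/\log 3$. $\binom{n}{m}$ is the usual binomial coefficient. *)

(* Defs.v *)
From mathcomp Require Import all_boot all_order all_algebra.
From mathcomp Require Import reals exp.

Set Implicit Arguments.
Unset Strict Implicit.
Unset Printing Implicit Defensive.

(* The pairs (n, m) of integers with 0 <= m <= n < N and 'C(n, m) coprime to 6.
   Such n and m both lie in {0, ..., N-1}, so that no pair is lost by taking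
   them in 'I_N. *)
Definition binom_coprime6 (N : nat) : {set 'I_N * 'I_N} :=
  [set nm : 'I_N * 'I_N | (nm.2 <= nm.1)%N && coprime 'C(nm.1, nm.2) 6].

(* Main.v *)
Require Import Defs.
From mathcomp Require Import all_boot all_order all_algebra all_field.
From mathcomp Require Import reals exp.
From mathcomp Require Import ring lra zify.

(** By Lucas' theorem, ['C(n, m)] is prime to [p] exactly when every base-[p]
    digit of [m] is at most the corresponding digit of [n]; call [(n, m)]
    dominated in base [p]. In base 2 this leaves three choices for each pair of
    digits, hence [3 ^ K] pairs below [2 ^ K], and this alone gives the main
    term [N `^ (ln 3 / ln 2)]. The logarithmic saving comes from also imposing
    dominance on the last [k] base-3 digits: this confines [(n, m)] to [6 ^ k]
    of the [9 ^ k] pairs of residue classes modulo [q = 3 ^ k]. If the pairs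
    dominated in base 2 are equidistributed among these classes up to a factor
    2, the count is at most [2 * 3 ^ K * (2 / 3) ^ k].

    Equidistribution is proved with the characters of [(Z / q) ^ 2]. The sum of
    [z ^ n * w ^ m] over the pairs dominated in base 2 is the product of the
    factors [1 + z ^ (2 ^ i) + (z * w) ^ (2 ^ i)] for [i < K]
    ([norm_char_sum]). For a nontrivial character, [z] or [z * w] is a
    nontrivial [q]-th root of unity [u]. Such a [u] is at distance at least
    [3 ^ (1 - k)] from 1 ([sqdist1_root]), and as long as the iterated square of
    [u] is within distance 1 of 1, squaring it once more multiplies this
    distance by at least the square root of 3. So after at most [2 * k]
    squarings it has left the unit disc around 1, and there the factor is at
    most [11 / 4] instead of 3. Each block of [2 * k] factors thus loses a
    constant ratio ([norm_prod_block]). Since [26 * k] blocks outweigh the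
    [9 ^ k] characters, equidistribution holds as soon as [K] exceeds a constant
    times [k ^ 2] ([residue_class_bound]).

    It remains to choose [k = 2 * up_log 3 K], which for large [K] is far below
    the square root of [K]: then [3 ^ k >= K ^ 2], and [(2 / 3) ^ k], a power of [3 ^ k]
    with exponent [- (1 - ln 2 / ln 3)], is at most
    [K `^ (- (2 * (1 - ln 2 / ln 3)))], where [K] is about [log_2 N]
    ([card_binom_coprime6_dyadic]). *)

Set Implicit Arguments.
Unset Strict Implicit.
Unset Printing Implicit Defensive.

Import Order.TTheory GRing.Theory Num.Theory.

(** * Binomial coefficients prime to p: Lucas' theorem *)

Section Lucas.
Local Open Scope nat_scope.

(** Vandermonde's convolution modulo [p]: only the two end terms survive,
    because [p] divides ['C(p, i)] for [0 < i < p]. This is Pascal's rule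
    with step [p], which drives the induction in [lucas_digit]. *)
Lemma bin_addp p n m : prime p ->
  'C(p + n, m) = 'C(n, m) + (p <= m) * 'C(n, m - p) %[mod p].
Proof.
move=> p_pr; rewrite -binomial.Vandermonde.
rewrite big_ord_recl /= bin0 mul1n subn0 -modnDmr -[RHS]modnDmr; congr ((_ + _) %% p).
have p_gt0 := prime_gt0 p_pr.
have step (i : 'I_m) : i.+1 != p -> p %| 'C(p, i.+1) * 'C(n, m - i.+1).
  move=> neq; apply: dvdn_mulr; case: (ltngtP i.+1 p) neq => // lt _.
    by apply: prime_dvd_bin => //; rewrite lt.
  by rewrite bin_small.
case: leqP => [le_pm|lt_mp].
  have lt : p.-1 < m by rewrite prednK.
  rewrite (bigD1 (Ordinal lt)) //= /bump /= add1n prednK // binn !mul1n.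
  apply/eqP; rewrite -[X in _ == X %[mod _]]addn0 eqn_modDl mod0n -/(dvdn p _).
  apply: dvdn_sum => i /eqP neq; rewrite /bump add1n; apply: step.
  by apply/eqP=> e; apply: neq; apply: val_inj; rewrite /= -e.
rewrite mul0n mod0n; apply/eqP; apply: dvdn_sum => i _; rewrite /bump add1n.
by apply: step; rewrite neq_ltn (leq_ltn_trans _ lt_mp).
Qed.

Lemma lucas_digit p n m a b : prime p -> a < p -> b < p ->
  'C(n * p + a, m * p + b) = 'C(n, m) * 'C(a, b) %[mod p].
Proof.
move=> p_pr ltap ltbp; elim: n m => [|n IHn] [|m].
- by rewrite bin0 mul1n.
- by rewrite mul0n bin_small // mulSn -addnA ltn_addr.
- have := IHn 0; rewrite mul0n add0n !bin0 mulSn -addnA bin_addp //.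
  by rewrite leqNgt ltbp [nat_of_bool _ * _]mul0n addn0.
rewrite mulSn -addnA bin_addp // [m.+1 * p in X in _ + X]mulSn -addnA.
rewrite leq_addr mul1n addKn.
by rewrite addnA -mulSn -modnDm IHn IHn modnDm -mulnDl binS.
Qed.

Definition digit_pairs p := [seq (a, b) | a <- iota 0 p, b <- iota 0 a.+1].

(** The digits of both entries below [p ^ k] are produced from the most
    significant one down, so that the recursion doubles (for [p = 2]) the
    pairs already built: this matches the squaring of the characters in
    [norm_char_sum]. *)
Fixpoint dominated p k : seq (nat * nat) :=
  if k is k'.+1 then
    [seq (x.1 * p + d.1, x.2 * p + d.2) | x <- dominated p k', d <- digit_pairs p]
  else [:: (0, 0)].

Lemma dominatedS p k :
  dominated p k.+1 =
    [seq (x.1 * p + d.1, x.2 * p + d.2) | x <- dominated p k, d <- digit_pairs p].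
Proof. by []. Qed.

Lemma modnS_digit p k n : n %% p ^ k.+1 = (n %/ p) %% p ^ k * p + n %% p.
Proof.
by rewrite expnSr modn_divl [LHS](divn_eq _ p) modn_dvdm ?dvdn_mull.
Qed.

(** With [n, m < p ^ k] this places the pair itself in the list (used in base
    2); for larger entries it constrains their residues (used in base 3). *)
Lemma mem_dominated p k n m : prime p -> ~~ (p %| 'C(n, m)) ->
  (n %% p ^ k, m %% p ^ k) \in dominated p k.
Proof.
move=> p_pr; have p_gt0 := prime_gt0 p_pr.
elim: k n m => [|k IHk] n m ndvd; first by rewrite expn0 !modn1 mem_head.
move: ndvd; rewrite {1}(divn_eq n p) {1}(divn_eq m p) /dvdn.
rewrite lucas_digit ?ltn_mod // -/(dvdn _ _) Euclid_dvdM // negb_or.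
case/andP=> /IHk mem_hi ndvd_lo; rewrite !modnS_digit /=.
apply/allpairsP; exists ((n %/ p %% p ^ k, m %/ p %% p ^ k), (n %% p, m %% p)).
split=> //; apply/allpairsPdep; exists (n %% p), (m %% p).
rewrite !mem_iota /= ltn_mod p_gt0; split=> //.
by rewrite ltnS leqNgt; apply: contra ndvd_lo => lt; rewrite bin_small.
Qed.

Lemma size_dominated p k : size (dominated p k) = size (digit_pairs p) ^ k.
Proof. by elim: k => //= k IHk; rewrite size_allpairs IHk expnSr. Qed.

End Lucas.

(** * Exponential sums over the pairs that are dominated in base 2 *)

Section CharacterSum.
Local Open Scope ring_scope.
Variable C : numClosedFieldType.
Implicit Types z w u v : C.

Lemma norm_unity_root q z : (0 < q)%N -> z ^+ q = 1 -> `|z| = 1.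
Proof.
by move=> q_gt0 zq; apply/eqP; rewrite -(@pexpr_eq1 _ _ q) // -normrX zq normr1.
Qed.

(** The identity that converts the distance of [z] to 1, which repeated
    squaring increases, into the size of [1 + z], which bounds the factors below. *)
Lemma sqnorm_parallelogram z : `|z| = 1 -> `|1 + z| ^+ 2 = 4 - `|z - 1| ^+ 2.
Proof.
move=> z1; have zz : z * z^* = 1 by rewrite -normCK z1 expr1n.
by rewrite !normCK !(rmorphD, rmorphN, rmorphB, rmorph1) /=; ring: zz.
Qed.

Lemma sqdist1_sqr z : `|z| = 1 ->
  `|z ^+ 2 - 1| ^+ 2 = `|z - 1| ^+ 2 * (4 - `|z - 1| ^+ 2).
Proof.
move=> z1; rewrite -sqnorm_parallelogram // -exprMn -normrM.
by congr (`|_| ^+ 2); ring.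
Qed.

(** Nontrivial [3 ^ k]-th roots of unity stay away from 1: cubing multiplies
    the distance to 1 by at most 3, and repeated cubing reaches a primitive
    cube root of unity, whose squared distance to 1 is 3. *)
Lemma sqdist1_root k z : z ^+ (3 ^ k) = 1 -> z != 1 ->
  27 <= `|z - 1| ^+ 2 * 9 ^+ k.
Proof.
elim: k z => [|k IHk] z; first by rewrite expr1 => ->; rewrite eqxx.
move=> zq z_neq1.
have z1 : `|z| = 1 by apply: norm_unity_root zq; rewrite expn_gt0.
have [z3|z3] := eqVneq (z ^+ 3) 1.
  have e : 1 + z = - z ^+ 2.
    apply: (mulfI (x := z - 1)); first by rewrite subr_eq0.
    by apply/eqP; rewrite -subr_eq0; apply/eqP; ring: z3.
  have := sqnorm_parallelogram z1; rewrite e normrN normrX z1 !expr1n => E.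
  have -> : `|z - 1| ^+ 2 = 3 by rewrite -[LHS](subKr 4) -E; ring.
  rewrite exprS mulrA -natrM ler_peMr ?ler0n //.
  by rewrite exprn_ege1 // ler1n.
rewrite expnS exprM in zq; apply: le_trans (IHk _ zq z3) _.
rewrite [9 ^+ k.+1]exprS mulrA ler_wpM2r ?exprn_ge0 ?ler0n //.
have -> : z ^+ 3 - 1 = (z - 1) * (z ^+ 2 + z + 1) by ring.
rewrite normrM exprMn ler_wpM2l ?exprn_ge0 //.
have -> : (9 : C) = 3 ^+ 2 by ring.
rewrite lerXn2r ?nnegrE ?ler0n //.
apply: le_trans (ler_normD _ _) _; rewrite normr1.
have -> : (3 : C) = 2 + 1 by ring.
rewrite lerD2r; apply: le_trans (ler_normD _ _) _.
by rewrite normrX z1 expr1n.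
Qed.

(** The modulus of the exponential sum, by [norm_char_sum]; it is kept in terms
    of [u = z] and [v = z * w], in which it is symmetric. *)
Definition norm_prod n u v : C := \prod_(i < n) `|1 + u ^+ (2 ^ i) + v ^+ (2 ^ i)|.

Lemma norm_prodC n u v : norm_prod n u v = norm_prod n v u.
Proof. by apply: eq_bigr => i _; rewrite addrAC. Qed.

Lemma norm_prod_ge0 n u v : 0 <= norm_prod n u v.
Proof. by apply: prodr_ge0 => i _. Qed.

Lemma norm_prodD n k u v :
  norm_prod (n + k) u v =
    norm_prod n u v * norm_prod k (u ^+ (2 ^ n)) (v ^+ (2 ^ n)).
Proof.
rewrite /norm_prod big_split_ord /=; congr (_ * _).
by apply: eq_bigr => i _; rewrite -!exprM -expnD.
Qed.

Lemma norm_prod_le n u v : `|u| = 1 -> `|v| = 1 -> norm_prod n u v <= 3 ^+ n.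
Proof.
move=> u1 v1; rewrite -[X in _ ^+ X]card_ord -prodr_const.
apply: ler_prod => i _; rewrite normr_ge0 /=.
apply: le_trans (ler_normD _ _) _; rewrite normrX v1 expr1n.
have -> : (3 : C) = 2 + 1 by ring.
by rewrite lerD2r (le_trans (ler_normD _ _)) // normrX u1 expr1n normr1.
Qed.

(** While [|u - 1| <= 1], squaring [u] multiplies [|u - 1| ^ 2] by at least 3.
    As this quantity never exceeds 4, under the hypothesis some
    [u ^ (2 ^ i)] with [i < n] is at distance more than 1 from 1, and its
    factor has modulus at most [Num.sqrt 3 + 1 <= 7 / 4 + 1]. *)
Lemma norm_prod_block n u v : `|u| = 1 -> `|v| = 1 ->
  4 < `|u - 1| ^+ 2 * 3 ^+ n -> norm_prod n u v <= 11 / 12 * 3 ^+ n.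
Proof.
elim: n u v => [|n IHn] u v u1 v1.
  rewrite mulr1 => lt4; have : 0 <= `|1 + u| ^+ 2 by rewrite exprn_ge0.
  by rewrite sqnorm_parallelogram // subr_ge0 => /(lt_le_trans lt4); rewrite ltxx.
move=> lt4; rewrite (norm_prodD 1) expn1 [3 ^+ n.+1]exprS mulrCA.
have u21 : `|u ^+ 2| = 1 by rewrite normrX u1 expr1n.
have v21 : `|v ^+ 2| = 1 by rewrite normrX v1 expr1n.
have Dr : `|u - 1| ^+ 2 \is Num.real by rewrite ger0_real ?exprn_ge0.
have [le1|gt1] := real_leP Dr (real1 C).
  apply: ler_pM; rewrite ?norm_prod_ge0 //.
    by have := norm_prod_le 1 u1 v1.
  apply: IHn => //; apply: lt_le_trans lt4 _.
  rewrite [3 ^+ n.+1]exprS mulrA ler_wpM2r ?exprn_ge0 ?ler0n //.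
  rewrite sqdist1_sqr // ler_wpM2l ?exprn_ge0 //.
  by rewrite lerBrDr -lerBrDl (le_trans le1) // -natrB.
have e : 11 / 12 * (3 * 3 ^+ n) = 11 / 4 * 3 ^+ n :> C by field.
rewrite mulrCA e; apply: ler_pM; rewrite ?norm_prod_ge0 ?norm_prod_le //.
rewrite /norm_prod big_ord1 !expr1; apply: le_trans (ler_normD _ _) _.
rewrite v1; have -> : 11 / 4 = 7 / 4 + 1 :> C by field.
rewrite lerD2r -(@ler_pXn2r _ 2) ?nnegrE ?divr_ge0 ?ler0n //.
rewrite sqnorm_parallelogram //; apply: (@le_trans _ _ 3).
  have -> : 3 = 4 - 1 :> C by ring.
  by rewrite lerD2l lerN2 ltW.
rewrite expr_div_n ler_pdivlMr ?exprn_gt0 ?ltr0n //.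
by rewrite -!natrX -natrM ler_nat.
Qed.

Lemma root3_pow2_neq1 k n u : u ^+ (3 ^ k) = 1 -> u != 1 -> u ^+ (2 ^ n) != 1.
Proof.
move=> u3 uN1; elim: n => [|n]; first by rewrite expr1.
apply: contraNneq => un; apply/eqP.
have : u ^+ (2 ^ n) ^+ (3 ^ k) = 1 by rewrite exprAC u3 expr1n.
(* An odd power of [x] and [x ^ 2] both equal to 1 force [x = 1]. *)
have := odd_double_half (3 ^ k); rewrite oddX orbT => <-.
by rewrite exprS -mul2n exprM -[_ ^+ 2]exprM -expnSr un expr1n mulr1.
Qed.

Lemma norm_prod_root k r u v : u ^+ (3 ^ k) = 1 -> u != 1 -> `|v| = 1 ->
  norm_prod (r * k.*2) u v <= (11 / 12) ^+ r * 3 ^+ (r * k.*2).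
Proof.
move=> u3 uN1 v1.
elim: r u v u3 uN1 v1 => [|r IHr] u v u3 uN1 v1.
  by rewrite mul0n /norm_prod big_ord0 !expr0 mulr1.
have u1 : `|u| = 1 by apply: norm_unity_root u3; rewrite expn_gt0.
rewrite mulSn norm_prodD exprS exprD mulrACA.
apply: ler_pM; rewrite ?norm_prod_ge0 //.
  apply: norm_prod_block => //; rewrite -mul2n exprM.
  have -> : 3 ^+ 2 = 9 :> C by ring.
  by apply: lt_le_trans (sqdist1_root u3 uN1); rewrite ltr_nat.
apply: IHr; first by rewrite exprAC u3 expr1n.
  exact: root3_pow2_neq1 u3 uN1.
by rewrite normrX v1 expr1n.
Qed.

(** For [q]-th roots of unity [z] and [w], the Fourier transform at the
    character [(n, m) |-> z ^ n * w ^ m] of the set of dominated pairs. *)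
Definition char_sum K z w : C := \sum_(x <- dominated 2 K) z ^+ x.1 * w ^+ x.2.

(** The lowest digits [(0, 0)], [(1, 0)], [(1, 1)] contribute the factor
    [1 + z + z * w], and the remaining digits the same sum at [z ^ 2, w ^ 2]. *)
Lemma norm_char_sum K z w : `|char_sum K z w| = norm_prod K z (z * w).
Proof.
elim: K z w => [|K IHK] z w.
  by rewrite /char_sum /norm_prod big_ord0 big_seq1 !expr0 mulr1 normr1.
rewrite (norm_prodD 1) expn1 exprMn -IHK.
rewrite /norm_prod big_ord1 !expr1 -normrM; congr `|_|.
rewrite /char_sum dominatedS big_allpairs_dep mulr_sumr; apply: eq_bigr => x _.
rewrite !big_cons big_nil /= !addn0 !exprD !expr1 !(mulnC _ 2) !exprM.
by ring.
Qed.

Lemma char_sum_bound k r K z w : (r * k.*2 <= K)%N ->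
  z ^+ (3 ^ k) = 1 -> w ^+ (3 ^ k) = 1 -> (z != 1) || (w != 1) ->
  `|char_sum K z w| <= (11 / 12) ^+ r * 3 ^+ K.
Proof.
move=> leK z3 w3 nontriv.
have norm1 u : u ^+ (3 ^ k) = 1 -> `|u| = 1.
  by apply: norm_unity_root; rewrite expn_gt0.
have zw3 : (z * w) ^+ (3 ^ k) = 1 by rewrite exprMn z3 w3 mulr1.
rewrite norm_char_sum -(subnKC leK) norm_prodD exprD mulrA.
apply: ler_pM; rewrite ?norm_prod_ge0 //; last first.
  by rewrite norm_prod_le // normrX norm1 ?expr1n.
have [z1|zN1] := eqVneq z 1; last by apply: norm_prod_root; rewrite ?norm1.
rewrite norm_prodC; apply: norm_prod_root; rewrite ?norm1 //.
by move: nontriv; rewrite z1 eqxx mul1r.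
Qed.

End CharacterSum.

(** * Equidistribution modulo powers of 3 *)

Section ResidueClasses.
Local Open Scope ring_scope.

Lemma sum_prim_root_powers (F : idomainType) q (z : F) u : q.-primitive_root z ->
  \sum_(a < q) z ^+ (a * u) = if (q %| u)%N then q%:R else 0.
Proof.
move=> z_prim; rewrite (prim_order_dvd z_prim).
rewrite (eq_bigr (fun a : 'I_q => (z ^+ u) ^+ a)); last first.
  by move=> a _; rewrite mulnC exprM.
case: eqP => [->|/eqP zu1].
  by rewrite (eq_bigr (fun=> 1)) ?sumr_const ?card_ord // => a _; rewrite expr1n.
apply: (mulfI (x := z ^+ u - 1)); first by rewrite subr_eq0.
by rewrite -subrX1 mulr0 exprAC (prim_expr_order z_prim) expr1n subrr.
Qed.

(** Fourier inversion on [(Z / q) ^ 2]. Taking shifts [c] and [d] to 0 avoids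
    negative residues: the class is that of [(- c, - d)]. *)
Lemma count_residue_class (F : idomainType) q (z : F) (s : seq (nat * nat)) (c d : nat) :
  q.-primitive_root z ->
  (q ^ 2 * count [pred x | (q %| x.1 + c) && (q %| x.2 + d)] s)%N%:R =
    \sum_(a < q) \sum_(b < q)
      z ^+ (a * c) * z ^+ (b * d) * \sum_(x <- s) (z ^+ a) ^+ x.1 * (z ^+ b) ^+ x.2.
Proof.
move=> z_prim; rewrite natrM natrX -sum1_count natr_sum big_mkcond mulr_sumr.
under [RHS]eq_bigr => a _ do
  (under eq_bigr => b _ do rewrite mulr_sumr; rewrite exchange_big).
rewrite exchange_big; apply: eq_bigr => x _ /=.
rewrite (eq_bigr (fun a : 'I_q => z ^+ (a * (x.1 + c)) *
   \sum_(b < q) z ^+ (b * (x.2 + d)))); last first.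
  move=> a _; rewrite mulr_sumr; apply: eq_bigr => b _.
  by rewrite -!exprM -!exprD; congr (_ ^+ _); lia.
rewrite -mulr_suml !sum_prim_root_powers //.
by case: (q %| _)%N; case: (q %| _)%N; rewrite ?mulr0 ?mul0r ?mulr1 // expr2.
Qed.

(** The trivial character contributes the expected [3 ^ K]. Any other loses
    the ratio [11 / 12] in each of [26 * k] blocks, and since
    [9 * (11 / 12) ^ 26 <= 1] the [9 ^ k] of them contribute at most another
    [3 ^ K] in total. *)
Lemma residue_class_bound k K c d : (26 * k * k.*2 <= K)%N ->
  ((3 ^ k) ^ 2 * count [pred x | (3 ^ k %| x.1 + c) && (3 ^ k %| x.2 + d)]
                       (dominated 2 K) <= 2 * 3 ^ K)%N.
Proof.
move=> leK; set q := (3 ^ k)%N; have q_gt0 : (0 < q)%N by rewrite expn_gt0.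
have [z z_prim] := C_prim_root_exists q_gt0.
rewrite -(ler_nat algC) (count_residue_class _ _ _ z_prim).
rewrite pair_bigA /=; set F := (F in \sum_p F p).
have norm_le p : `|F p| <= `|char_sum K (z ^+ p.1) (z ^+ p.2)|.
  have z1 : `|z| = 1 := norm_unity_root q_gt0 (prim_expr_order z_prim).
  by rewrite /F !normrM !normrX z1 !expr1n !mul1r.
pose p0 := (Ordinal q_gt0, Ordinal q_gt0).
apply: le_trans (real_ler_norm _) _.
  rewrite /F -(pair_bigA _ (fun a b : 'I_q => z ^+ (a * c) * z ^+ (b * d) *
     \sum_(x <- dominated 2 K) (z ^+ a) ^+ x.1 * (z ^+ b) ^+ x.2)) /=.
  by rewrite -count_residue_class // realn.
apply: le_trans (ler_norm_sum _ _ _) _.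
rewrite (bigD1 p0) //= natrM mulr_natl mulr2n natrX; apply: lerD.
  apply: le_trans (norm_le _) _; rewrite /= norm_char_sum.
  by rewrite norm_prod_le ?expr0 ?mulr1 ?normr1.
apply: (@le_trans _ _ (\sum_(p : 'I_q * 'I_q) (11 / 12) ^+ (26 * k) * 3 ^+ K)).
  (* The trivial character is put back, which makes the sum constant. *)
  rewrite [leRHS](bigD1 p0) //= ler_wpDl //.
    by rewrite mulr_ge0 ?exprn_ge0 ?divr_ge0 ?ler0n.
  apply: ler_sum => p pN0; apply: le_trans (norm_le p) _.
  apply: char_sum_bound leK _ _ _; rewrite -?exprM.
  - by rewrite mulnC exprM (prim_expr_order z_prim) expr1n.
  - by rewrite mulnC exprM (prim_expr_order z_prim) expr1n.
  rewrite -!(prim_order_dvd z_prim) -negb_and; apply: contra pN0.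
  case: p => a b /= /andP[/eqP qa /eqP qb].
  apply/eqP; congr (_, _); apply: val_inj => /=.
    by rewrite -qa modn_small.
  by rewrite -qb modn_small.
rewrite sumr_const card_prod card_ord -[leLHS]mulr_natl mulrA.
rewrite ler_piMl ?exprn_ge0 ?ler0n // /q -expnMn natrX exprM -exprMn exprn_ile1 //.
  by rewrite mulr_ge0 ?exprn_ge0 ?divr_ge0 ?ler0n.
rewrite expr_div_n mulrA ler_pdivrMr ?exprn_gt0 ?ltr0n // mul1r.
by rewrite -!natrX -natrM ler_nat; lia.
Qed.

End ResidueClasses.

(** * Counting the pairs with a binomial coefficient coprime to 6 *)

Section Counting.
Local Open Scope nat_scope.

(** Only [6 ^ k] of the [9 ^ k] residue classes are dominated in base 3, and
    each holds at most [2 * 3 ^ K / 9 ^ k] pairs dominated in base 2. *)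
Lemma card_binom_coprime6_le k K N : N <= 2 ^ K -> 26 * k * k.*2 <= K ->
  3 ^ k * #|binom_coprime6 N| <= 2 ^ k * (2 * 3 ^ K).
Proof.
move=> leN leK; set q := 3 ^ k.
have q_gt0 : 0 < q by rewrite expn_gt0.
pose red (x : nat * nat) := (x.1 %% q, x.2 %% q).
have count_le : #|binom_coprime6 N| <=
    count [pred x | red x \in dominated 3 k] (dominated 2 K).
  pose f (x : 'I_N * 'I_N) := (val x.1, val x.2).
  have f_inj : injective f by move=> [a b] [c d] [] /val_inj-> /val_inj->.
  rewrite cardE -(size_map f) -size_filter; apply: uniq_leq_size.
    by rewrite map_inj_uniq ?enum_uniq.
  move=> _ /mapP[[n m] + ->]; rewrite mem_enum inE /= => /andP[_].
  rewrite coprime_sym (coprimeMl _ 2 3) !prime_coprime //.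
  case/andP=> odd2 nd3; rewrite mem_filter /= mem_dominated //=.
  have lt i : (i : 'I_N) < 2 ^ K by apply: leq_trans leN.
  by have := mem_dominated K _ odd2; rewrite !modn_small //; apply.
have class_le c : q ^ 2 * count [pred x | red x == c] (dominated 2 K) <= 2 * 3 ^ K.
  apply: leq_trans (residue_class_bound (q - c.1) (q - c.2) leK).
  rewrite leq_mul2l; apply/orP; right; apply: sub_count => x /eqP <- /=.
  (* The truncated subtraction is exact, as [u %% q < q]. *)
  have dvd_shift u : q %| u + (q - u %% q).
    rewrite {1}(divn_eq u q) -addnA subnKC ?(ltnW (ltn_pmod _ _)) //.
    by rewrite -mulSnr dvdn_mull.
  by rewrite !dvd_shift.
have union_le (s : seq (nat * nat)) :
  q ^ 2 * count [pred x | red x \in s] (dominated 2 K) <= size s * (2 * 3 ^ K).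
  elim: s => [|c s IHs]; first by rewrite (eq_count (a2 := pred0)) ?count_pred0 ?muln0.
  rewrite mulSn; apply: leq_trans (leq_add (class_le c) IHs).
  rewrite -mulnDr leq_mul2l; apply/orP; right.
  rewrite -count_predUI; apply: leq_trans (leq_addr _ _).
  by apply: sub_count => x /=; rewrite inE.
have : q ^ 2 * #|binom_coprime6 N| <= 6 ^ k * (2 * 3 ^ K).
  apply: leq_trans (leq_mul (leqnn _) count_le) _.
  by apply: leq_trans (union_le _) _; rewrite size_dominated.
by rewrite -[6]/(3 * 2) expnMn -/q -mulnn -!mulnA leq_pmul2l.
Qed.

End Counting.

(** * From powers of 2 and 3 to powers of N and log N *)

Section RealBounds.
Local Open Scope ring_scope.
Variable R : realType.

Lemma powR_ln_ratio (x y : R) : 1 < x -> 0 < y -> x `^ (ln y / ln x) = y.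
Proof.
move=> x1 y0; have x0 : 0 < x by apply: lt_trans x1.
by rewrite /powR gt_eqF // divfK ?lnK ?posrE // gt_eqF // ln_gt0.
Qed.

(** The condition [26 * k * k.*2 <= K] for [k = u.*2], where [3 ^ u.-1 < K]. *)
Lemma quadratic_le_exp3 u : (11 <= u)%N -> (208 * u ^ 2 <= 3 ^ u.-1)%N.
Proof.
move=> le11u; rewrite -(subnK le11u); elim: (u - 11)%N => [|n IHn].
  by rewrite add0n -[11.-1]/10%N; lia.
have -> : ((n.+1 + 11).-1 = (n + 11).-1.+1)%N by lia.
rewrite [(3 ^ _.+1)%N]expnS; apply: leq_trans (leq_mul (leqnn 3) IHn).
by rewrite -!mulnn; nia.
Qed.

Let s : R := 1 - ln 2 / ln 3.

Lemma saving_exponent_ge0 : 0 <= s.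
Proof.
rewrite subr_ge0 ler_pdivrMr ?ln_gt0 ?ltr1n // mul1r.
by rewrite ler_ln ?posrE ?ltr0n // ler_nat.
Qed.

(** The reason for the exponent in the theorem: the saving [2 / 3] per base-3
    digit is the power [- s] of the modulus [3]. *)
Lemma exp2_div_exp3 k : 2 ^+ k / 3 ^+ k = (3 ^+ k) `^ (- s) :> R.
Proof.
have p3 : 0 < 3 ^+ k :> R by rewrite exprn_gt0 ?ltr0n.
apply: (canLR (mulfK _)); first by rewrite gt_eqF.
rewrite -[X in _ * X]powRr1 ?(ltW p3) // -powRD ?(gt_eqF p3) ?implybT //.
rewrite /s opprB subrK -powR_mulrn ?ler0n // powRAC powR_ln_ratio ?ltr1n ?ltr0n //.
by rewrite powR_mulrn.
Qed.

(** For large [K], take [k = 2 * up_log 3 K] in [card_binom_coprime6_le]. For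
    [K <= 3 ^ 10] this [k] may be too large for equidistribution; the choice
    [k = 0] gives the trivial bound [2 * 3 ^ K], and the factor [M] makes the
    constant large enough. *)
Lemma card_binom_coprime6_dyadic : exists2 C : R, 0 < C &
  forall K N : nat, (0 < K)%N -> (N <= 2 ^ K)%N ->
    #|binom_coprime6 N|%:R <= C * 3 ^+ K * K%:R `^ (- (2 * s)).
Proof.
have s0 := saving_exponent_ge0; have s20 : 0 <= 2 * s by rewrite mulr_ge0.
set M : R := (3 ^+ 10) `^ (2 * s).
have M1 : 1 <= M.
  by rewrite -[1](powRr0 (3 ^+ 10)) ler_powR // exprn_ege1 // ler1n.
exists (2 * M) => [|K N K0 leN]; first by rewrite mulr_gt0 // (lt_le_trans ltr01).
have Kgt0 : 0 < K%:R :> R by rewrite ltr0n.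
have [leK|ltK] := leqP K (3 ^ 10).
  have := card_binom_coprime6_le (k := 0) leN (leq0n _).
  rewrite !mul1n -(ler_nat R) natrM natrX => /le_trans; apply.
  have -> : 2 * M * 3 ^+ K * K%:R `^ (- (2 * s)) =
            2 * 3 ^+ K * (M / K%:R `^ (2 * s)) by rewrite powRN; ring.
  rewrite ler_peMr ?mulr_ge0 ?exprn_ge0 // ler_pdivlMr ?powR_gt0 // mul1r.
  by rewrite ge0_ler_powR ?nnegrE ?exprn_ge0 // -natrX ler_nat.
have lt11u : (10 < up_log 3 K)%N.
  by rewrite ltnNge; apply: contraL ltK => le_u10; rewrite -leqNgt
    (leq_trans (up_logP K (isT : 1 < 3)%N)) // leq_exp2l.
set u := up_log 3 K in lt11u; pose k := u.*2.
have leK : (26 * k * k.*2 <= K)%N.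
  have K1 : (1 < K)%N by apply: leq_ltn_trans ltK; rewrite expn_gt0.
  apply: leq_trans (ltnW (up_log_gtn (isT : 1 < 3)%N K1)); rewrite -/u.
  by apply: leq_trans (quadratic_le_exp3 lt11u); rewrite /k -!mul2n; lia.
have := card_binom_coprime6_le leN leK.
rewrite -(ler_nat R) !natrM !natrX mulrC -ler_pdivlMr ?exprn_gt0 ?ltr0n //.
move=> /le_trans; apply.
have -> : 2 ^+ k * (2 * 3 ^+ K) / 3 ^+ k =
          2 * 3 ^+ K * (2 ^+ k / 3 ^+ k) :> R by ring.
have saved : (3 ^+ k) `^ (- s) <= K%:R `^ (- (2 * s)) :> R.
  rewrite !powRN lef_pV2 ?posrE ?powR_gt0 ?exprn_gt0 ?ltr0n //.
  rewrite powRrM ge0_ler_powR ?nnegrE ?powR_ge0 ?exprn_ge0 //.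
  rewrite (powR_mulrn 2) ?ler0n // /k -muln2 exprM.
  by rewrite lerXn2r ?nnegrE ?ler0n ?exprn_ge0 // -natrX ler_nat up_logP.
have -> : 2 * M * 3 ^+ K * K%:R `^ (- (2 * s)) =
          2 * 3 ^+ K * (M * K%:R `^ (- (2 * s))) by ring.
rewrite exp2_div_exp3 ler_wpM2l ?mulr_ge0 ?exprn_ge0 //.
by apply: le_trans saved _; rewrite ler_peMl ?powR_ge0.
Qed.

End RealBounds.

Local Open Scope ring_scope.

Theorem theorem1p3 (R : realType) (eps : R) (eps_gt0 : 0 < eps) :
  exists2 C : R, 0 < C &
    forall N : nat, (2 <= N)%N ->
      #|binom_coprime6 N|%:R <=
        C * ((N%:R `^ (ln 3 / ln 2)) /
             ((ln N%:R) `^ (2 * (1 - ln 2 / ln 3) - eps))).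
Proof.
have [C C_gt0 leC] := card_binom_coprime6_dyadic R.
have ln2_gt0 : 0 < ln 2 :> R by rewrite ln_gt0 ?ltr1n.
exists (3 * C * (ln 2) `^ (- eps)) => [|N le2N].
  by rewrite !mulr_gt0 ?powR_gt0.
have N_gt0 : (0 < N)%N by apply: leq_trans le2N.
set s := 1 - ln 2 / ln 3; set K := up_log 2 N.
have K_gt0 : (0 < K)%N by rewrite up_log_gt0.
have leN : (N <= 2 ^ K)%N by apply: up_logP.
apply: le_trans (leC K N K_gt0 leN) _.
have lnN_ge : ln 2 <= ln N%:R :> R by rewrite ler_ln ?posrE ?ltr0n // ler_nat.
have lnN_gt0 : 0 < ln N%:R :> R by apply: lt_le_trans lnN_ge.
have lnN_le : ln N%:R <= K%:R :> R.
  apply: (@le_trans _ _ (ln (2 ^+ K))).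
    by rewrite ler_ln ?posrE ?exprn_gt0 ?ltr0n // -natrX ler_nat.
  rewrite lnXn ?ltr0n // -[leLHS]mulr_natr ler_piMl ?ler0n //.
  by apply: (le_ln1Dx (x := 1)); lra.
(* [N] lies above [2 ^ K.-1], whence the factor 3. *)
have pow3 : 3 ^+ K <= 3 * N%:R `^ (ln 3 / ln 2) :> R.
  rewrite -(prednK K_gt0) exprS ler_wpM2l //.
  rewrite -[X in X ^+ _](@powR_ln_ratio R 2 3) ?ltr1n ?ltr0n //.
  rewrite -powR_mulrn ?powR_ge0 // powRAC powR_mulrn //.
  rewrite ge0_ler_powR ?nnegrE ?exprn_ge0 //.
    by rewrite divr_ge0 ?ln_ge0 ?ler1n.
  by rewrite -natrX ler_nat ltnW // up_log_gtn.
(* [ln N] may be below 1 (for [N = 2]); the factor [ln 2 `^ (- eps)] covers the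
   loss of [eps] in the exponent there. *)
have powK : K%:R `^ (- (2 * s)) <= (ln 2) `^ (- eps) / (ln N%:R) `^ (2 * s - eps) :> R.
  rewrite powRD ?(gt_eqF lnN_gt0) ?implybT // invfM mulrCA -powRN.
  rewrite -[leLHS]mulr1 ler_pM ?powR_ge0 //.
    rewrite !powRN lef_pV2 ?posrE ?powR_gt0 ?ltr0n //.
    rewrite ge0_ler_powR ?nnegrE ?ler0n ?(ltW lnN_gt0) //.
    by rewrite mulr_ge0 ?saving_exponent_ge0.
  rewrite ler_pdivlMr ?powR_gt0 // mul1r !powRN lef_pV2 ?posrE ?powR_gt0 //.
  by rewrite ge0_ler_powR ?nnegrE ?(ltW lnN_gt0) ?(ltW ln2_gt0) ?(ltW eps_gt0).
have -> : 3 * C * ln 2 `^ (- eps) *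
    (N%:R `^ (ln 3 / ln 2) / ln N%:R `^ (2 * s - eps)) =
  C * (3 * N%:R `^ (ln 3 / ln 2)) *
    (ln 2 `^ (- eps) / ln N%:R `^ (2 * s - eps)) by ring.
rewrite ler_pM ?powR_ge0 //; first by rewrite mulr_ge0 ?exprn_ge0 ?(ltW C_gt0).
by rewrite ler_wpM2l ?(ltW C_gt0).
Qed.
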